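(* Let $\delta\in(0,n]$, $p\in(1,\infty)$ and $w\in\mathcal A_{p,\delta}$. Then there is a number $q$ with $1<q<p$, depending only on $n,\delta,p$ and $[w]_{\mathcal A_{p,\delta}}$, such that $w\in\mathcal A_{q,\delta}$.
   Context: A cube $Q\subset\mathbb R^n$ is a left-open right-closed cube with sides parallel to the axes; $l(Q)$ is its edge length. For $\delta\in(0,n]$ and $E\subset\mathbb R^n$, the Hausdorff content is $\mathcal H^\delta_\infty(E):=\inf\{\sum_i l(Q_i)^\delta:\ E\subset\bigcup_i Q_i\}$, the infimum over all finite or countable coverings of $E$ by cubes. For $E\subset\mathbb R^n$ and a non-negative function $g$ (no measurability required) the Choquet integral is $\int_E g\,d\mathcal H^\delta_\infty:=\int_0^\infty \mathcal H^\delta_\infty(\{x\in E: g(x)>t\})\,dt$. ''Almost everywhere'' with respect to $\mathcal H^\delta_\infty$ means outside a set of zero $\mathcal H^\delta_\infty$-content. A capacitary weight is a non-negative function $w$ with $\int_E w\,d\mathcal H^\delta_\infty<\infty$ for all compact $E$ and $w\in(0,\infty)$ $\mathcal H^\delta_\infty$-almost everywhere. For $p\in(1,\infty)$, $w\in\mathcal A_{p,\delta}$ means $w$ is a capacitary weight with $[w]_{\mathcal A_{p,\delta}}:=\sup_Q\{\frac1{\mathcal H^\delta_\infty(Q)}\int_Qw\,d\mathcal H^\delta_\infty\}\{\frac1{\mathcal H^\delta_\infty(Q)}\int_Qw^{-\frac1{p-1}}d\mathcal H^\delta_\infty\}^{p-1}<\infty$ (supremum over all cubes). *)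

(* Defs.v *)
From HB Require Import structures.
From mathcomp Require Import all_boot all_order all_algebra.
From mathcomp Require Import all_classical all_reals all_analysis.

Set Implicit Arguments.
Unset Strict Implicit.
Unset Printing Implicit Defensive.

Import Order.TTheory GRing.Theory Num.Theory.
Import numFieldNormedType.Exports.

Local Open Scope classical_set_scope.
Local Open Scope ring_scope.
Local Open Scope ereal_scope.

(* The product of the intervals ]a_i, a_i + l]; a genuine cube requires
   0 < l, which is imposed wherever cubes are quantified over. *)
Definition cube (R : realType) (n : nat) (a : 'rV[R]_n) (l : R) :
  set 'rV[R]_n :=
  [set x | forall i : 'I_n, (a ord0 i < x ord0 i <= a ord0 i + l)%R].

(* The index set D ranges over all subsets of nat, so that both finite and
   countably infinite coverings are allowed. *)
Definition hcontent (R : realType) (n : nat) (delta : R)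
    (E : set 'rV[R]_n) : \bar R :=
  ereal_inf [set s | exists (D : set nat) (a : nat -> 'rV[R]_n)
                            (l : nat -> R),
    [/\ forall i, D i -> (0 < l i)%R,
        E `<=` \bigcup_(i in D) cube (a i) (l i) &
        s = \esum_(i in D) ((l i) `^ delta)%:E]].

Definition choquet (R : realType) (n : nat) (delta : R)
    (E : set 'rV[R]_n) (g : 'rV[R]_n -> \bar R) : \bar R :=
  \int[@lebesgue_measure R]_(t in `]0%R, +oo[)
    hcontent delta [set x | E x /\ t%:E < g x].

Definition hcontent_ae (R : realType) (n : nat) (delta : R)
    (P : 'rV[R]_n -> Prop) : Prop :=
  hcontent delta [set x | ~ P x] = 0.

Definition capacitary_weight (R : realType) (n : nat) (delta : R)
    (w : 'rV[R]_n -> \bar R) : Prop :=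
  [/\ forall x, 0 <= w x,
      forall E : set 'rV[R]_n, compact E -> choquet delta E w < +oo &
      hcontent_ae delta (fun x => 0 < w x < +oo)].

(* w^(-1/(p-1)) is written as the (1/(p-1))-th power of the extended inverse,
   for which 0^-1 = +oo and +oo^-1 = 0; poweR with a negative exponent would
   instead give 0 at 0 and +oo at +oo. *)
Definition Ap_const (R : realType) (n : nat) (delta p : R)
    (w : 'rV[R]_n -> \bar R) : \bar R :=
  ereal_sup [set c | exists (a : 'rV[R]_n) (l : R), (0 < l)%R /\
    c = ((hcontent delta (cube a l))^-1 * choquet delta (cube a l) w) *
        ((hcontent delta (cube a l))^-1 *
         choquet delta (cube a l) (fun x => (w x)^-1 `^ (p - 1)^-1))
          `^ (p - 1)].

Definition Ap_weight (R : realType) (n : nat) (delta p : R)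
    (w : 'rV[R]_n -> \bar R) : Prop :=
  capacitary_weight delta w /\ Ap_const delta p w < +oo.

(* Main.v *)
Require Import Defs.
From HB Require Import structures.
From mathcomp Require Import all_boot all_order all_algebra.
From mathcomp Require Import all_classical all_reals all_analysis.
From mathcomp Require Import measurable_realfun.
From mathcomp Require Import ring lra.

Import Order.TTheory GRing.Theory Num.Theory.
Import numFieldNormedType.Exports.

Local Open Scope classical_set_scope.
Local Open Scope ring_scope.

(** Write <f>_Q for the average of f over a cube Q, that is the Choquet
    integral of f over Q divided by the content of Q, and put
    sigma = w^(-1/(p-1)). If q - 1 = (p - 1)/(1 + e) then w^(-1/(q-1)) is
    sigma^(1+e), so the theorem follows from a reverse Hoelder inequality
    <sigma^(1+e)>_Q <= M <sigma>_Q^(1+e) in which e and M depend only on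
    n, delta, p and the A_p constant ([reverse_hoelder]).

    The A_p condition provides a number eta > 0 ([Ap_oscillates]) such that on
    every cube with <sigma> > t, the set where sigma > eta t has at least
    half of the content of the cube. Indeed w is large where sigma <= eta t, so
    if that set were substantial then <w> <sigma>^(p-1) would be too large.

    For Lebesgue measure one would now use additivity and the differentiation
    theorem. Neither is at hand: the content is only countably subadditive and
    w is an arbitrary function. The substitute is [le_stopping_content], which
    shows that the integral of sigma over its own superlevel set
    E = (Q and sigma > s) is at most C s times the content of E, whenever
    s >= eta <sigma>_Q. Cover E efficiently by dyadic cells of Q. A cell lying
    in no cell of large average satisfies the desired bound itself. All other
    cells are absorbed into the maximal cells of large average that contain
    them; a maximal cell has controlled average because its parent does not
    have large average, and its size is controlled by the total size of the
    covering cells inside it, because E fills half of it. Summing over the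
    covering cells gives the bound, and only subadditivity has been used.

    Comparing with the layer-cake formula at the levels s 2^k
    ([sum_superlevel_le_choquet]), each term s 2^k H(sigma > s 2^k) dominates,
    up to a constant, the sum of all later ones; such a sequence decays
    geometrically ([tail_sum_decay]), with a ratio theta < 1. Choosing e with
    2^e theta < 1 makes the sum that bounds <sigma^(1+e)>_Q converge.

    The content of a cube is computed by a zero-one law
    ([hcontent_cube_zero_one]): either it is l^delta for every cube, or it
    vanishes on all cubes. In the second case every average is 0 and the
    A_q constant is 0 for each q. *)

Set Implicit Arguments.
Unset Strict Implicit.
Unset Printing Implicit Defensive.

(** * Countable families and the Hausdorff content *)

Section CountableFamilies.
Local Open Scope ereal_scope.

Lemma esum_le_mull (R : realType) (I : choiceType) (D : set I) (r : R)
    (f : I -> \bar R) : (0 <= r)%R -> (forall i, 0 <= f i) ->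
  \esum_(i in D) (r%:E * f i) <= r%:E * \esum_(i in D) f i.
Proof.
move=> r0 f0; apply: ge_ereal_sup => _ [X [finX XD] <-].
rewrite -ge0_mule_fsumr// lee_wpmul2l ?lee_fin//.
by apply: ereal_sup_ubound; exists X.
Qed.

(** Dyadic cells and pairs of indices serve as index sets below; this spares
    their enumeration by natural numbers. *)
Lemma outer_measure_bigcup_le_esum (R : realType) (T : Type) (I : countType)
    (mu : {outer_measure set T -> \bar R}) (D : set I) (F : I -> set T) :
  mu (\bigcup_(i in D) F i) <= \esum_(i in D) mu (F i).
Proof.
pose G k := \bigcup_(i in D `&` [set i | pickle i = k]) F i.
have -> : \bigcup_(i in D) F i = \bigcup_k G k.
  apply/seteqP; split=> [x [i Di Fix]|x [k _ [i [Di _] Fix]]].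
    by exists (pickle i) => //; exists i.
  by exists i.
apply: le_trans (outer_measure_sigma_subadditive mu G) _.
rewrite nneseries_esumT; last by move=> k; exact: outer_measure_ge0.
rewrite [leLHS](_ : _ = \esum_(k in pickle @` D) mu (G k)); last first.
  rewrite [RHS]esum_mkcond; apply: eq_esum => k _; case: ifPn => // /negP kD.
  rewrite /G (_ : _ `&` _ = set0) ?bigcup_set0 ?outer_measure0//.
  by apply/seteqP; split=> // i [Di ik]; apply: kD; rewrite inE; exists i.
rewrite esum_image; last by move=> i j _ _; exact: (pcan_inj pickleK).
apply: le_esum => i Di; apply: le_outer_measure => x [j [_ /= ji]].
by rewrite (pcan_inj pickleK ji).
Qed.

End CountableFamilies.

Section HausdorffContent.
Local Open Scope ereal_scope.
Variables (R : realType) (n : nat) (delta : R).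
Implicit Types (E : set 'rV[R]_n) (a : 'rV[R]_n) (l : R).

Lemma hcontent_le_esum (I : countType) (D : set I) (a : I -> 'rV[R]_n)
    (l : I -> R) E : (forall i, D i -> (0 < l i)%R) ->
  E `<=` \bigcup_(i in D) cube (a i) (l i) ->
  hcontent delta E <= \esum_(i in D) ((l i) `^ delta)%:E.
Proof.
move=> l0 ED; apply: ereal_inf_lbound.
pose b k := if @unpickle I k is Some i then a i else 0%R.
pose m k := if @unpickle I k is Some i then l i else 0%R.
exists (pickle @` D), b, m; split.
- by move=> _ [i Di <-]; rewrite /m pickleK; exact: l0.
- by move=> x /ED[i Di ix]; exists (pickle i); [exists i|rewrite /b /m pickleK].
- rewrite esum_image; last by move=> i j _ _; exact: (pcan_inj pickleK).
  by apply: eq_esum => i _; rewrite /m pickleK.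
Qed.

Lemma hcontent_ge0 E : 0 <= hcontent delta E.
Proof.
apply: le_ereal_inf_tmp => _ [D [a [l [_ _ ->]]]].
by apply: esum_ge0 => i _; rewrite lee_fin powR_ge0.
Qed.

Lemma le_hcontent : {homo @hcontent R n delta : E F / E `<=` F >-> E <= F}.
Proof.
move=> E F EF; apply: ereal_inf_le_tmp => s [D [a [l [l0 FD ->]]]].
by exists D, a, l; split=> //; exact: subset_trans FD.
Qed.

Lemma hcontent0 : hcontent delta (@set0 'rV[R]_n) = 0.
Proof.
apply/eqP; rewrite eq_le hcontent_ge0 andbT.
have := @hcontent_le_esum nat set0 (fun=> 0%R) (fun=> 0%R) set0.
by rewrite esum_set0; apply=> // i [].
Qed.

Lemma hcontent_cube_le a l : (0 < l)%R ->
  hcontent delta (cube a l) <= (l `^ delta)%:E.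
Proof.
move=> l0; have := @hcontent_le_esum unit [set tt] (fun=> a) (fun=> l) (cube a l).
rewrite esum_set1 ?lee_fin ?powR_ge0//; apply=> // x xa; by exists tt.
Qed.

(** The union of covers of the F i, each within e / 2^(i+1) of optimal, is a
    cover of the union, indexed by pairs. *)
Lemma hcontent_sigma_subadditive : sigma_subadditive (@hcontent R n delta).
Proof.
move=> F; set S := (X in _ <= X).
have [->|Sfin] := eqVneq S +oo; first by rewrite leey.
have Hfin i : hcontent delta (F i) \is a fin_num.
  rewrite ge0_fin_numE ?hcontent_ge0//; apply: le_lt_trans (_ : S < _).
    rewrite /S nneseries_esumT; last by move=> k; exact: hcontent_ge0.
    apply: esum_ge; exists [set i]; first by split.
    by rewrite fsbig_set1.
  by rewrite ltey.
apply/lee_addgt0Pr => e e0.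
have cov i : exists C : set nat * ((nat -> 'rV[R]_n) * (nat -> R)),
    [/\ forall j, C.1 j -> (0 < C.2.2 j)%R,
     F i `<=` \bigcup_(j in C.1) cube (C.2.1 j) (C.2.2 j) &
     \esum_(j in C.1) ((C.2.2 j) `^ delta)%:E <=
       hcontent delta (F i) + (e / (2 ^ i.+1)%:R)%:E].
  have ei : (0 < e / (2 ^ i.+1)%:R)%R by rewrite divr_gt0// ltr0n expn_gt0.
  have [_ [D [a [l [l0 FD ->]]]] le] := lb_ereal_inf_adherent ei (Hfin i).
  by exists (D, (a, l)); split=> //; exact: ltW.
have [C HC] := choice cov.
apply: le_trans (epsilon_trick xpredT (fun i => hcontent_ge0 (F i)) (ltW e0)).
rewrite [leRHS]nneseries_esumT; last first.
  by move=> i; rewrite adde_ge0 ?hcontent_ge0// lee_fin divr_ge0 ?ltW.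
apply: le_trans (le_esum (a := fun i => \esum_(j in (C i).1)
  (((C i).2.2 j) `^ delta)%:E) _); last by move=> i _; have [] := HC i.
rewrite esum_esum; last by move=> i j _ _; rewrite lee_fin powR_ge0.
apply: (@hcontent_le_esum (nat * nat)%type _
  (fun k => (C k.1).2.1 k.2) (fun k => (C k.1).2.2 k.2)).
  by move=> [i j] [_ /= Cj]; have [+ _ _] := HC i; exact.
move=> x [i _ Fix]; have [_ + _] := HC i => /(_ _ Fix)[j Cj jx].
by exists (i, j).
Qed.

End HausdorffContent.

HB.instance Definition _ (R : realType) (n : nat) (delta : R) :=
  isOuterMeasure.Build R 'rV[R]_n (@hcontent R n delta) (hcontent0 n delta)
    (@hcontent_ge0 R n delta) (@le_hcontent R n delta)
    (@hcontent_sigma_subadditive R n delta).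

Section Scaling.
Local Open Scope ereal_scope.
Variables (R : realType) (n : nat) (delta : R).
Implicit Types (E : set 'rV[R]_n) (a b : 'rV[R]_n) (l m : R).

(** The affine map that sends one cube onto the other transports covers, and
    multiplies all edges by l / m. *)
Lemma hcontent_cube_scale a b l m : (0 < l)%R -> (0 < m)%R ->
  hcontent delta (cube a l) <= ((l / m) `^ delta)%:E * hcontent delta (cube b m).
Proof.
move=> l0 m0; have lm0 : (0 < l / m)%R by rewrite divr_gt0.
have r0 : (0 < (l / m) `^ delta)%R by rewrite powR_gt0.
rewrite muleC -lee_pdivrMr//; apply: le_ereal_inf_tmp => _ [D [c [s [s0 cov ->]]]].
rewrite lee_pdivrMr// muleC.
have := @hcontent_le_esum R n delta nat D
  (fun i => a + (l / m) *: (c i - b))%R (fun i => (l / m * s i)%R) (cube a l).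
move=> /(_ _ _)/le_trans; apply.
- by move=> i Di; rewrite mulr_gt0// s0.
- move=> x xa; pose y := (b + (m / l) *: (x - a))%R.
  have yb : cube b m y.
    move=> i; have /andP[] := xa i; rewrite !mxE.
    move=> h1 h2.
    have e1 : (0 < m / l * (x ord0 i - a ord0 i))%R.
      by rewrite mulr_gt0 ?divr_gt0// subr_gt0.
    have e2 : (m / l * (x ord0 i - a ord0 i) <= m)%R.
      rewrite -[leRHS](@divfK _ l) ?gt_eqF// ler_pM2l ?divr_gt0//.
      by rewrite lerBlDl.
    by apply/andP; split; lra.
  have [i Di yi] := cov _ yb; exists i => // j.
  have := yi j; rewrite !mxE => /andP[h1 h2].
  have -> : x ord0 j =
      (a ord0 j + l / m * ((b ord0 j + m / l * (x ord0 j - a ord0 j)) - b ord0 j))%R.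
    by field; rewrite !gt_eqF.
  rewrite ltrD2l ltr_pM2l// ltrD2r h1/= -[leRHS]addrA lerD2l -mulrDr ler_pM2l//.
  lra.
- apply: le_trans; last apply: esum_le_mull.
  + apply: le_esum => i Di; by rewrite powRM ?EFinM// ltW// s0.
  + exact: ltW.
  + by move=> i; rewrite lee_fin powR_ge0.
Qed.

(** By scaling, the content of a cube is c l^delta with c <= 1 the content of
    the unit cube. Every cover of the unit cube then gives c <= c * sum, hence
    c <= c * c, so that c is 0 or 1. *)
Lemma hcontent_cube_zero_one :
  (forall a l, (0 < l)%R -> hcontent delta (cube a l) = 0) \/
  (forall a l, (0 < l)%R -> hcontent delta (cube a l) = (l `^ delta)%:E).
Proof.
set Q := @cube R n 0%R 1%R.
have Q1 : hcontent delta Q <= 1.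
  by have := @hcontent_cube_le R n delta 0%R 1%R ltr01; rewrite powR1.
have Qfin : hcontent delta Q \is a fin_num.
  by rewrite ge0_fin_numE ?hcontent_ge0// (le_lt_trans Q1)// ltry.
have scaleQ a l : (0 < l)%R ->
    hcontent delta (cube a l) <= (l `^ delta)%:E * hcontent delta Q.
  by move=> l0; rewrite -{2}[l]divr1; exact: hcontent_cube_scale.
have [Q0|Q0] := eqVneq (hcontent delta Q) 0.
  left=> a l l0; apply/eqP; rewrite eq_le hcontent_ge0 andbT.
  by have := scaleQ a l l0; rewrite Q0 mule0.
have HQ : hcontent delta Q = 1.
  apply/eqP; rewrite eq_le Q1/=.
  have Qpos : 0 < hcontent delta Q by rewrite lt0e Q0 hcontent_ge0.
  move: Qpos Q1 scaleQ; rewrite -(fineK Qfin).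
  set c := fine _; rewrite lte_fin => c0 c1 scaleQ.
  rewrite -(@lee_pmul2l _ c%:E)// mule1.
  have -> : c%:E * c%:E = hcontent delta Q * c%:E by rewrite [in LHS]/c fineK.
  rewrite -lee_pdivrMr//.
  apply: le_ereal_inf_tmp => _ [D [a [s [s0 cov ->]]]].
  rewrite lee_pdivrMr// muleC [leLHS](_ : _ = hcontent delta Q); last exact: fineK.
  apply: le_trans (_ : hcontent delta (\bigcup_(i in D) cube (a i) (s i)) <= _).
    exact: le_hcontent.
  apply: le_trans (outer_measure_bigcup_le_esum _ _ _) _.
  apply: le_trans; last apply: esum_le_mull.
  - by apply: le_esum => i Di; rewrite muleC; apply: scaleQ; exact: s0.
  - exact: ltW.
  - by move=> i; rewrite lee_fin powR_ge0.
right=> a l l0; apply/eqP; rewrite eq_le hcontent_cube_le//=.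
have := @hcontent_cube_scale 0%R a 1%R l ltr01 l0; rewrite HQ => h.
have ld : (0 < l `^ delta)%R by rewrite powR_gt0.
rewrite -[leLHS]mule1; apply: (le_trans (lee_wpmul2l (ltW ld : 0 <= (l `^ delta)%:E) h)).
rewrite muleA -EFinM -powRM ?divr_ge0 ?(ltW l0)// mulrCA divff ?gt_eqF//.
by rewrite mulr1 powR1 mul1e.
Qed.

End Scaling.

(** * The Choquet integral as an outer measure *)

Section MonotoneIntegrals.
Local Open Scope ereal_scope.
Variables (R : realType) (f : R -> \bar R).
Hypothesis f_ge0 : forall t, 0 <= f t.
Hypothesis f_nonincr : {homo f : s t / (s <= t)%R >-> t <= s}.

Lemma nonincreasing_emeasurable (D : set R) : measurable D -> measurable_fun D f.
Proof.
move=> mD; apply: (measurability _ (measurable_realfun.ErealGenOInfty.measurableE R)).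
move=> _ [_ [a ->] <-]; apply: measurableI => //; apply: is_interval_measurable.
move=> s t /=; rewrite !in_itv/= !andbT => _ ft u /andP[_ ut].
by rewrite in_itv/= andbT (lt_le_trans ft)// f_nonincr.
Qed.

Lemma integral_ray_split (r s : R) : (r <= s)%R ->
  \int[@lebesgue_measure R]_(t in `]r, +oo[) f t =
  \int[@lebesgue_measure R]_(t in `]r, s]) f t +
  \int[@lebesgue_measure R]_(t in `]s, +oo[) f t.
Proof.
move=> rs; rewrite -ge0_integral_setU//.
- by rewrite -itv_bndbnd_setU// bnd_simp.
- by apply: nonincreasing_emeasurable; exact: measurableU.
- apply/disj_setPS => t []/=; rewrite !in_itv/= andbT => /andP[_ ts] st.
  by move: (lt_le_trans st ts); rewrite ltxx.
Qed.

Lemma lebesgue_measure_itvoc (r s : R) : (r <= s)%R ->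
  lebesgue_measure `]r, s]%classic = (s - r)%:E.
Proof.
rewrite le_eqVlt => /predU1P[->|rs].
  by rewrite lebesgue_measure_itv/= lte_fin ltxx subrr.
by rewrite lebesgue_measure_itv/= lte_fin rs EFinB.
Qed.

(** Together with the next lemma this is how all Choquet integrals are
    estimated below: the integrand is monotone, so it is compared with a
    constant on an interval and the rest of the ray is kept. *)
Lemma integral_ray_ge (r s : R) (k : \bar R) : (r <= s)%R -> 0 <= k ->
  (forall t, (r < t < s)%R -> k <= f t) ->
  k * (s - r)%:E + \int[@lebesgue_measure R]_(t in `]s, +oo[) f t <=
  \int[@lebesgue_measure R]_(t in `]r, +oo[) f t.
Proof.
move=> rs k0 kf; rewrite (integral_ray_split rs) leeD2r//.
rewrite -integral_itv_bndo_bndc; last exact: nonincreasing_emeasurable.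
rewrite -(lebesgue_measure_itvoc rs) -integral_cst//=.
rewrite -[leLHS]integral_itv_bndo_bndc//.
by apply: ge0_le_integral => //; exact: nonincreasing_emeasurable.
Qed.

Lemma integral_ray_le (r s : R) (k : \bar R) : (r <= s)%R -> 0 <= k ->
  (forall t, (r < t < s)%R -> f t <= k) ->
  \int[@lebesgue_measure R]_(t in `]r, +oo[) f t <=
  k * (s - r)%:E + \int[@lebesgue_measure R]_(t in `]s, +oo[) f t.
Proof.
move=> rs k0 kf; rewrite (integral_ray_split rs) leeD2r//.
rewrite -integral_itv_bndo_bndc; last exact: nonincreasing_emeasurable.
rewrite -(lebesgue_measure_itvoc rs) -integral_cst//=.
rewrite -[leRHS]integral_itv_bndo_bndc//.
by apply: ge0_le_integral => //; exact: nonincreasing_emeasurable.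
Qed.

End MonotoneIntegrals.

Section Choquet.
Local Open Scope ereal_scope.
Variables (R : realType) (n : nat) (delta : R).
Implicit Types (E F : set 'rV[R]_n) (g : 'rV[R]_n -> \bar R).

(** The distribution function of g on E; the Choquet integral is its integral
    over the positive half-line. *)
Definition superlevel E g t := hcontent delta [set x | E x /\ t%:E < g x].

Lemma superlevel_ge0 E g t : 0 <= superlevel E g t.
Proof. exact: hcontent_ge0. Qed.

Lemma superlevel_nonincr E g :
  {homo superlevel E g : s t / (s <= t)%R >-> t <= s}.
Proof.
move=> s t st; apply: le_hcontent => x [Ex tg]; split=> //.
by rewrite (le_lt_trans _ tg)// lee_fin.
Qed.

Lemma superlevel_emeasurable E g : measurable_fun (`]0%R, +oo[ : set R) (superlevel E g).
Proof. by apply: nonincreasing_emeasurable => //; exact: superlevel_nonincr. Qed.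

Lemma choquet_ge0 E g : 0 <= choquet delta E g.
Proof. by apply: integral_ge0 => t _; exact: superlevel_ge0. Qed.

Lemma choquet_set0 g : choquet delta set0 g = 0.
Proof.
apply: integral0_eq => t _; rewrite -[RHS](@hcontent0 R n delta).
by congr hcontent; apply/seteqP; split=> // x [].
Qed.

Lemma le_choquet g : {homo (fun E => choquet delta E g) : E F / E `<=` F >-> E <= F}.
Proof.
move=> E F EF; apply: ge0_le_integral => //.
- by move=> t _; exact: superlevel_ge0.
- exact: superlevel_emeasurable.
- exact: superlevel_emeasurable.
- by move=> t _; apply: le_hcontent => x [/EF].
Qed.

(** For fixed g, subadditivity in the set is inherited from the content level
    by level. *)
Lemma choquet_sigma_subadditive g : sigma_subadditive (fun E => choquet delta E g).
Proof.
move=> E; rewrite [leRHS](_ : _ = \int[@lebesgue_measure R]_(t in `]0%R, +oo[)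
    \sum_(i <oo) superlevel (E i) g t); last first.
  rewrite integral_nneseries// => i; first exact: superlevel_emeasurable.
  by move=> t _; exact: superlevel_ge0.
apply: ge0_le_integral => //.
- by move=> t _; exact: superlevel_ge0.
- exact: superlevel_emeasurable.
- apply: ge0_emeasurable_sum => [k t _ _|k _]; first exact: superlevel_ge0.
  exact: superlevel_emeasurable.
- move=> t _; apply: le_trans (hcontent_sigma_subadditive _ _).
  by apply: le_hcontent => x [[i _ Eix] tg]; exists i.
Qed.

Lemma choquet_le E g (M : R) : (0 <= M)%R -> (forall x, E x -> g x <= M%:E) ->
  choquet delta E g <= M%:E * hcontent delta E.
Proof.
move=> M0 gM.
apply: le_trans (integral_ray_le (@superlevel_ge0 E g) (@superlevel_nonincr E g) M0 (hcontent_ge0 delta E) _) _.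
  by move=> t _; apply: le_hcontent => x [].
rewrite subr0 muleC integral0_eq ?adde0// => t /=; rewrite in_itv/= andbT => Mt.
rewrite -[RHS](@hcontent0 R n delta); congr hcontent; apply/seteqP; split=> // x [Ex].
by rewrite ltNge (le_trans (gM _ Ex))// lee_fin ltW.
Qed.

Lemma choquet_ge E F g (c : R) : (0 <= c)%R -> F `<=` E ->
  (forall x, F x -> c%:E <= g x) ->
  c%:E * hcontent delta F <= choquet delta E g.
Proof.
move=> c0 FE cg.
apply: le_trans (integral_ray_ge (@superlevel_ge0 E g) (@superlevel_nonincr E g) c0 (hcontent_ge0 delta F) _).
  rewrite subr0 muleC leeDl// integral_ge0// => t _; exact: superlevel_ge0.
move=> t /andP[_ tc]; apply: le_hcontent => x Fx; split; first exact: FE.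
by rewrite (lt_le_trans _ (cg _ Fx))// lte_fin.
Qed.

(** Layer cake over dyadic levels: the distribution function is at least
    its value at u on the interval from u / 2 to u, and these intervals are
    disjoint for u = s 2^j. *)
Lemma sum_superlevel_le_choquet E g (s : R) (m : nat) : (0 < s)%R ->
  \sum_(j < m) ((s * 2 ^+ j)%:E * superlevel E g (s * 2 ^+ j)) <=
  2%:E * choquet delta E g.
Proof.
move=> s0.
pose tail r := \int[@lebesgue_measure R]_(t in `]r, +oo[) superlevel E g t.
have tail_ge0 r : 0 <= tail r.
  by apply: integral_ge0 => t _; exact: superlevel_ge0.
rewrite -lee_pdivrMl//.
have tail_anti r r' : (r <= r')%R -> tail r' <= tail r.
  move=> rr'; rewrite [leRHS](integral_ray_split (@superlevel_ge0 E g) (@superlevel_nonincr E g) rr').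
  by rewrite leeDr// integral_ge0// => t _; exact: superlevel_ge0.
suff H : 2^-1%:E * \sum_(j < m) ((s * 2 ^+ j)%:E * superlevel E g (s * 2 ^+ j)) +
    tail (s * 2 ^+ m / 2)%R <= tail (s / 2)%R.
  apply: le_trans (_ : tail (s / 2)%R <= _); last first.
    by apply/tail_anti/divr_ge0 => //; exact: ltW.
  by apply: le_trans H; rewrite leeDl.
elim: m => [|m IH]; first by rewrite big_ord0 mule0 add0e expr0 mulr1.
apply: le_trans IH; rewrite big_ord_recr/= ge0_muleDr; last 2 first.
- by apply: sume_ge0 => i _; rewrite mule_ge0 ?superlevel_ge0// lee_fin mulr_ge0 ?exprn_ge0// ltW.
- by rewrite mule_ge0 ?superlevel_ge0// lee_fin mulr_ge0 ?exprn_ge0// ltW.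
rewrite -addeA leeD2l//.
set u := (s * 2 ^+ m)%R; have u0 : (0 < u)%R by rewrite mulr_gt0// exprn_gt0.
rewrite exprSr mulrA -/u mulfK//.
have uu : (u / 2 <= u)%R by rewrite ler_pdivrMr// ler_peMr// ?ler1n// ltW.
apply: le_trans (integral_ray_ge (@superlevel_ge0 E g) (@superlevel_nonincr E g) uu (@superlevel_ge0 E g u) _).
  rewrite leeD2r// muleA -EFinM muleC.
  by have -> : (2^-1 * u = u - u / 2)%R by field.
by move=> t /andP[_ tu]; apply: superlevel_nonincr; exact: ltW.
Qed.

End Choquet.

(** The Choquet integral of g as a function of the set alone, a name that can
    carry the structure of an outer measure. *)
Definition choquet_on (R : realType) (n : nat) (delta : R)
    (g : 'rV[R]_n -> \bar R) (E : set 'rV[R]_n) := choquet delta E g.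

HB.instance Definition _ (R : realType) (n : nat) (delta : R)
    (g : 'rV[R]_n -> \bar R) :=
  isOuterMeasure.Build R 'rV[R]_n (choquet_on delta g)
    (choquet_set0 delta g) (fun E => choquet_ge0 delta E g) (@le_choquet R n delta g)
    (@choquet_sigma_subadditive R n delta g).

(** * Dyadic cells of a cube *)

Section DyadicCells.
Variables (R : realType) (n : nat) (a : 'rV[R]_n) (L : R).
Hypothesis L0 : 0 < L.
Implicit Types (x y : 'rV[R]_n) (k j : nat) (m : {ffun 'I_n -> int}).

Definition side k := L / 2 ^+ k.

(** Cells of generation k are encoded by the integer vectors m of their upper
    corners, in units of the edge. Rounding up matches the left-open,
    right-closed convention. *)
Definition dyadic_index k x : {ffun 'I_n -> int} :=
  [ffun i => Num.ceil ((x ord0 i - a ord0 i) / side k)].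

Definition corner k m : 'rV[R]_n :=
  \row_i (a ord0 i + (m i - 1)%:~R * side k).

Definition cell (c : nat * {ffun 'I_n -> int}) := cube (corner c.1 c.2) (side c.1).

Lemma side_gt0 k : 0 < side k.
Proof. by rewrite divr_gt0// exprn_gt0. Qed.

Lemma sideS k : side k = 2 * side k.+1.
Proof. by rewrite /side exprS; field; rewrite expf_neq0// pnatr_eq0. Qed.

Lemma cellP k m x : cell (k, m) x <-> dyadic_index k x = m.
Proof.
have s0 := side_gt0 k; split=> [xm|<- i]; last first.
  rewrite /= !mxE ffunE.
  have /andP[h1 h2] := ceil_itv ((x ord0 i - a ord0 i) / side k).
  move: h1 h2; rewrite ltr_pdivlMr// ler_pdivrMr// => h1 h2.
  apply/andP; split; first by rewrite addrC -ltrBrDr.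
  by move: h2; rewrite intrB mulr1z; lra.
apply/ffunP => i; rewrite ffunE; apply/eqP; rewrite ceil_eq.
have := xm i; rewrite /= !mxE ltr_pdivlMr// ler_pdivrMr// => /andP[h1 h2].
apply/andP; split; first by rewrite ltrBrDl.
by move: h2; rewrite intrB mulr1z; lra.
Qed.

(** Nestedness: the rounding up of z / 2 depends only on the rounding up of z. *)
Lemma dyadic_indexS k x y :
  dyadic_index k.+1 x = dyadic_index k.+1 y -> dyadic_index k x = dyadic_index k y.
Proof.
move=> xy; apply/ffunP => i; rewrite !ffunE.
have := congr1 (fun f : {ffun 'I_n -> int} => f i) xy; rewrite !ffunE (sideS k).
set u := _ / side k.+1; set v := _ / side k.+1 => uv.
have half z : (z / (2 * side k.+1)) = (z / side k.+1) / 2.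
  by field; rewrite gt_eqF// side_gt0.
rewrite !half -/u -/v; clearbody u v; apply/eqP; rewrite ceil_eq.
have /andP[] := ceil_itv (v / 2).
move: (Num.ceil (v / 2)) => w.
rewrite ltr_pdivlMr// ler_pdivrMr// ltr_pdivlMr// ler_pdivrMr//.
have two : (2 : R) = 2%:~R by [].
by rewrite two -!intrM -!ceil_le_int -!ceil_gt_int uv => -> ->.
Qed.

Lemma dyadic_index_le j k x y : (j <= k)%N ->
  dyadic_index k x = dyadic_index k y -> dyadic_index j x = dyadic_index j y.
Proof.
move=> /subnK <-; elim: (k - j)%N => // d IH; rewrite addSn => /dyadic_indexS.
exact: IH.
Qed.

Lemma cell0 : cell (0%N, [ffun=> 1]) = cube a L.
Proof.
rewrite /cell/=; congr cube; last by rewrite /side expr0 divr1.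
by apply/rowP => i; rewrite !mxE ffunE subrr mul0r addr0.
Qed.

Lemma dyadic_index0 x : cube a L x <-> dyadic_index 0 x = [ffun=> 1].
Proof. by rewrite -cell0; exact: cellP. Qed.

Lemma dyadic_scale (s : R) : 0 < s -> s <= L ->
  exists k, s <= side k <= 2 * s.
Proof.
move=> s0 sL.
have /ex_minnP[k ks kmin] : exists k, side k.+1 < s.
  exists (Num.truncn (L / s)); rewrite /side ltr_pdivrMr ?exprn_gt0//.
  rewrite mulrC -ltr_pdivrMr//; apply: lt_trans (truncnS_gt _) _.
  by rewrite -natrX ltr_nat ltn_expl.
exists k; rewrite [in X in _ && X](sideS k) ler_pM2l// (ltW ks) andbT.
case: k kmin {ks} => [_|k kmin]; first by rewrite /side expr0 divr1.
by rewrite leNgt; apply/negP => /kmin; rewrite ltnn.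
Qed.

(** The cell m and its neighbours in the positive directions, 2^n in all. *)
Definition shift_index m (e : {ffun 'I_n -> bool}) : {ffun 'I_n -> int} :=
  [ffun i => m i + (e i)%:Z].

(** An interval no longer than the edge meets at most two consecutive intervals
    of the grid, in each coordinate. *)
Lemma cube_sub_cells k (b : 'rV[R]_n) (s : R) : s <= side k ->
  exists m, cube b s `<=` \bigcup_e cell (k, shift_index m e).
Proof.
move=> sk; exists (dyadic_index k b) => x xb.
exists [ffun i => dyadic_index k b i < dyadic_index k x i] => //.
apply/cellP/ffunP => i; rewrite !ffunE; have s0 := side_gt0 k.
set u := (x ord0 i - _) / _; set v := (b ord0 i - _) / _.
have /andP[bx xs] := xb i.
have vu : v <= u by rewrite ler_pM2r ?invr_gt0// lerB// ltW.
have uv : u <= v + 1.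
  rewrite /u ler_pdivrMr// mulrDl divfK ?gt_eqF// mul1r.
  by move: (le_trans xs (lerD (lexx _) sk)); lra.
have : Num.ceil u <= Num.ceil v + 1.
  by rewrite ceil_le_int intrD (le_trans uv)// lerD2r ceil_ge.
have := le_ceil vu; case: ltgtP => // [h _ h2|-> _ _]; last by rewrite addr0.
by apply/eqP; rewrite eq_le h2/= lezD1.
Qed.

End DyadicCells.

(** * The stopping-time estimate *)

Lemma subset_esum (R : realType) (I : choiceType) (A B : set I) (f : I -> \bar R) :
  A `<=` B -> (\esum_(i in A) f i <= \esum_(i in B) f i)%E.
Proof.
move=> AB; apply: ge_ereal_sup => _ [X [finX XA] <-].
by apply: ereal_sup_ubound; exists X => //; split=> // i /XA/AB.
Qed.

Section Stopping.
Local Open Scope ereal_scope.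
Variables (R : realType) (n : nat) (delta : R).
Variables (a : 'rV[R]_n) (L : R).
Hypothesis L0 : (0 < L)%R.
Variables (nu : {outer_measure set 'rV[R]_n -> \bar R}) (E : set 'rV[R]_n) (t : R).
Hypothesis t0 : (0 <= t)%R.
Hypothesis EQ : E `<=` cube a L.
Hypothesis nuQ : nu (cube a L) <= (t * L `^ delta)%:E.
Hypothesis dense : forall b s, (0 < s)%R -> cube b s `<=` cube a L ->
  (t * s `^ delta)%:E < nu (cube b s) ->
  (s `^ delta)%:E <= 2%:E * hcontent delta (E `&` cube b s).

Let idx := dyadic_index a L.
Let sd k := (side L k `^ delta)%R.

(** Cells are given by a generation k j and a point x j of E that they contain.
    Call a cell c bad when nu c > t (side c)^delta, which forces E to fill half
    of it, and a cell of the cover good when neither it nor any of its ancestors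
    is bad. Call c top when it is bad, has no bad strict ancestor, contains some
    x j and lies in no good cell. A good cell has mass at most t (side)^delta.
    A top cell c has mass at most 2^delta t (side c)^delta, by its parent, and
    (side c)^delta is at most twice the content of the part of E in c, which is
    covered by the cells of the cover inside c. Different top cells are
    disjoint, so no cell of the cover is counted twice. *)
Lemma stopping_cells (J : countType) (D : set J) (k : J -> nat)
    (x : J -> 'rV[R]_n) :
  (forall j, D j -> E (x j)) ->
  E `<=` \bigcup_(j in D) cell a L (k j, idx (k j) (x j)) ->
  nu E <= ((1 + 2 * 2 `^ delta) * t)%:E * \esum_(j in D) (sd (k j))%:E.
Proof.
move=> xE cov.
have cE i m y : cell a L (i, m) y <-> idx i y = m by exact: cellP.
have nest i i' y z : (i <= i')%N -> idx i' y = idx i' z -> idx i y = idx i z.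
  exact: dyadic_index_le.
have sd0 i : (0 <= sd i)%R by exact: powR_ge0.
pose bad c := (t * sd c.1)%:E < nu (cell a L c).
pose good j := forall i, (i <= k j)%N -> ~~ bad (i, idx i (x j)).
pose top c := [/\ bad c,
  exists j, [/\ D j, c.2 = idx c.1 (x j) &
    forall i, (i < c.1)%N -> ~~ bad (i, idx i (x j))] &
  forall j, D j -> good j -> ~ (cell a L c `<=` cell a L (k j, idx (k j) (x j)))].
pose G c := [set j | [/\ D j, (c.1 <= k j)%N & idx c.1 (x j) = c.2]].
pose S := \esum_(j in D) (sd (k j))%:E.
have covE : E `<=` (\bigcup_(j in D `&` good) cell a L (k j, idx (k j) (x j)))
                   `|` \bigcup_(c in top) cell a L c.
  move=> y Ey; have [j Dj yj] := cov y Ey.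
  have [gj|] := pselect (good j); first by left; exists j.
  move=> /existsNP[i0 /not_implyP[i0k /negP/negPn badi0]].
  have /ex_minnP[i badi imin] : exists i, bad (i, idx i (x j)) by exists i0.
  pose c := (i, idx i (x j)).
  have ik : (i <= k j)%N by exact: leq_trans (imin _ badi0) i0k.
  have yc : cell a L c y by apply/cE/(nest _ _ _ _ ik)/cE.
  have [inside|outside] := pselect (exists2 j', (D `&` good) j' &
      cell a L c `<=` cell a L (k j', idx (k j') (x j'))).
    by case: inside => j' gj' sub; left; exists j' => //; exact: sub.
  right; exists c => //; split=> //.
    exists j; split=> // i' i'i; apply/negP => /imin; by rewrite leqNgt i'i.
  by move=> j' Dj' gj' sub; apply: outside; exists j'.
have goodS : nu (\bigcup_(j in D `&` good) cell a L (k j, idx (k j) (x j))) <= t%:E * S.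
  apply: le_trans (outer_measure_bigcup_le_esum _ _ _) _.
  apply: (@le_trans _ _ (\esum_(j in D) (t%:E * (sd (k j))%:E))).
    apply: le_trans (subset_esum _ (@subIsetl _ D good)).
    apply: le_esum => j [_ gj]; rewrite -EFinM leNgt.
    exact: (gj _ (leqnn _)).
  by apply: esum_le_mull => // j; rewrite lee_fin.
have topnu c : top c -> nu (cell a L c) <= (t * 2 `^ delta)%:E * (sd c.1)%:E.
  case: c => -[|i] m [badc [j [Dj /= mj prev]] _].
    (* generation 0: the cell meets E, so it is the whole cube, which is not bad *)
    have : m = [ffun=> 1%R] by rewrite mj; apply/dyadic_index0 => //; exact/EQ/xE.
    move=> me; move: badc; rewrite /bad me cell0 /sd/= /side expr0 divr1.
    by rewrite ltNge nuQ.
  have := prev i (ltnSn i); rewrite -leNgt => h.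
  apply: le_trans (_ : nu (cell a L (i, idx i (x j))) <= _).
    apply: le_outer_measure => y /cE yi; apply/cE.
    by apply: (nest _ i.+1) => //; rewrite yi mj.
  apply: (le_trans h); rewrite -EFinM lee_fin /= /sd (sideS L i) powRM//.
    by rewrite mulrA.
  exact/ltW/side_gt0.
have topcov c : top c -> (sd c.1)%:E <= 2%:E * \esum_(j in G c) (sd (k j))%:E.
  case: c => i m [badc [j [Dj /= mj prev]] out].
  have sub : cell a L (i, m) `<=` cube a L.
    move=> y /cE yi; apply/dyadic_index0 => //; have /dyadic_index0 <- // := EQ (xE _ Dj).
    by apply: (nest _ i) => //; rewrite yi.
  apply: le_trans (dense (side_gt0 L0 i) sub badc) _.
  apply: lee_wpmul2l => //.
  apply: (@hcontent_le_esum _ _ _ _ _ (fun j' => corner a L (k j') (idx (k j') (x j')))) => [j' _|y [Ey /cE yi]].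
    exact: side_gt0.
  have [j' Dj' yj'] := cov y Ey; have {}yj' := (cE _ _ _).1 yj'.
  exists j'; last exact/cE.
  (* a covering cell that meets the top cell cannot be a larger one: if good it
     would contain the top cell, and otherwise it has a bad ancestor, which
     would be a bad strict ancestor of the top cell *)
  have [ik|ki] := leqP i (k j').
    by split=> //; rewrite -[in RHS]yi; apply: (nest _ _ _ _ ik).
  exfalso; have [gj|] := pselect (good j').
    apply: (out _ Dj' gj) => z /cE zi; apply/cE; rewrite -yj'.
    by apply: (nest _ i); [exact: ltnW|rewrite zi yi].
  apply=> i' i'k; have <- : idx i' (x j) = idx i' (x j').
    rewrite -(nest _ _ _ _ i'k yj'); apply: (nest _ i); last by rewrite yi mj.
    exact: leq_trans (ltnW ki).
  exact/prev/(leq_ltn_trans i'k).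
have topS : \esum_(c in top) \esum_(j in G c) (sd (k j))%:E <= S.
  rewrite esum_esum; last by move=> *; rewrite lee_fin.
  rewrite -(@esum_image _ _ _ (top `*`` G) snd (fun j => (sd (k j))%:E)).
    by apply: subset_esum => _ [[c j] [_ [Dj _ _]] <-].
  (* a cell of the cover lies in one top cell only *)
  have lt_absurd c c' j : top c -> top c' -> G c j -> G c' j -> ~ (c.1 < c'.1)%N.
    case: c c' => [i m] [i' m'] [badc _ _] [_ [j0 [_ /= mj0 prev]] _] [_ /= _ jm] [_ _ /= jm'] ii'.
    have := prev i ii'; have <- : idx i (x j) = idx i (x j0).
      by apply: (nest _ i'); [exact: ltnW|rewrite jm' mj0].
    by rewrite jm badc.
  move=> [c j] [c' j'] /set_mem[/= tc Gc] /set_mem[/= tc' Gc'] jj'.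
  rewrite -{}jj' in Gc' *; congr (_, _).
  have : c.1 = c'.1.
    have [h|h|//] := ltngtP c.1 c'.1.
      by case: (lt_absurd _ _ _ tc tc' Gc Gc' h).
    by case: (lt_absurd _ _ _ tc' tc Gc' Gc h).
  case: Gc Gc' => [_ _ e] [_ _ e'] cc'.
  by apply: injective_projections => //; rewrite -e -e' cc'.
have S0 : 0 <= S by apply: esum_ge0 => *; rewrite lee_fin.
have topnuS : nu (\bigcup_(c in top) cell a L c) <= (2 * 2 `^ delta * t)%:E * S.
  apply: le_trans (outer_measure_bigcup_le_esum _ _ _) _.
  apply: (@le_trans _ _ (\esum_(c in top)
     ((2 * 2 `^ delta * t)%:E * \esum_(j in G c) (sd (k j))%:E))).
    apply: le_esum => c tc; apply: le_trans (topnu c tc) _.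
    have t2 : (0 <= t * 2 `^ delta)%R by rewrite mulr_ge0// powR_ge0.
    apply: (le_trans (lee_wpmul2l (_ : 0 <= (t * 2 `^ delta)%:E) (topcov c tc))) => //.
    by rewrite muleA -EFinM; have -> : (t * 2 `^ delta * 2 = 2 * 2 `^ delta * t)%R by ring.
  apply: le_trans; first apply: esum_le_mull.
  - by rewrite !mulr_ge0// powR_ge0.
  - by move=> c; apply: esum_ge0 => *; rewrite lee_fin.
  - by apply: lee_wpmul2l => //; rewrite lee_fin !mulr_ge0// powR_ge0.
apply: le_trans (le_outer_measure nu _ _ covE) _.
apply: le_trans (outer_measureU2 _ _ _) _.
rewrite mulrDl mul1r EFinD ge0_muleDl ?lee_fin//; last by rewrite !mulr_ge0// powR_ge0.
exact: leeD.
Qed.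

End Stopping.

Section StoppingContent.
Local Open Scope ereal_scope.
Variables (R : realType) (n : nat) (delta : R).
Hypothesis delta0 : (0 < delta)%R.

(** The first factor comes from [stopping_cells]; the second one is the cost of
    replacing a cube by 2^n dyadic cells of at most twice its edge. *)
Definition stopping_factor : R :=
  ((1 + 2 * 2 `^ delta) * (#|{ffun 'I_n -> bool}|%:R * 2 `^ delta))%R.

Lemma stopping_factor_gt0 : (0 < stopping_factor)%R.
Proof.
have p2 : (0 < 2 `^ delta :> R)%R by rewrite powR_gt0.
have N0 : (0 < #|{ffun 'I_n -> bool}|%:R :> R)%R.
  by rewrite ltr0n card_ffun card_bool expn_gt0.
by rewrite /stopping_factor mulr_gt0// ?addr_gt0// mulr_gt0.
Qed.

Lemma esum_finType (I : finType) (f : I -> \bar R) : (forall i, 0 <= f i) ->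
  \esum_(i in [set: I]) f i = \sum_i f i.
Proof.
move=> f0; rewrite esum_fset//; last exact: finite_finset.
rewrite (_ : [set: I] = [set` index_enum I]).
  by rewrite -fsbig_seq// index_enum_uniq.
by apply/seteqP; split=> // i _ /=; rewrite mem_index_enum.
Qed.

(** It remains to replace the cubes of an arbitrary cover by dyadic cells of
    comparable size, keeping only the cells that meet E. *)
Lemma le_stopping_content (a : 'rV[R]_n) (L : R)
    (nu : {outer_measure set 'rV[R]_n -> \bar R}) (E : set 'rV[R]_n) (t : R) :
  (0 < L)%R -> (0 < t)%R -> E `<=` cube a L ->
  nu (cube a L) <= (t * L `^ delta)%:E ->
  (forall b s, (0 < s)%R -> cube b s `<=` cube a L ->
    (t * s `^ delta)%:E < nu (cube b s) ->
    (s `^ delta)%:E <= 2%:E * hcontent delta (E `&` cube b s)) ->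
  nu E <= (stopping_factor * t)%:E * hcontent delta E.
Proof.
move=> L0 t0 EQ nuQ dense.
have r0 : (0 < stopping_factor * t)%R by rewrite mulr_gt0// stopping_factor_gt0.
rewrite muleC -lee_pdivrMr//.
apply: le_ereal_inf_tmp => _ [D [b [s [s0 cov ->]]]]; rewrite lee_pdivrMr// muleC.
have cells i : exists km : nat * {ffun 'I_n -> int}, D i ->
    (side L km.1 <= 2 * s i)%R /\
    cube a L `&` cube (b i) (s i) `<=` \bigcup_e cell a L (km.1, shift_index km.2 e).
  have [Di|nDi] := pselect (D i); last by exists (0%N, [ffun=> 0%R]).
  have [sL|Ls] := leP (s i) L.
    have [k /andP[sk ks]] := dyadic_scale (s0 i Di) sL.
    have [m sub] := @cube_sub_cells _ _ a _ L0 k (b i) (s i) sk.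
    by exists (k, m) => _; split=> // x [_ /sub].
  (* a cube larger than the whole is replaced by the whole *)
  exists (0%N, [ffun=> 1%R]) => _; split.
    by rewrite /side expr0 divr1; move: (s0 i Di) Ls; lra.
  move=> x [xQ _]; exists [ffun=> false] => //=.
  rewrite (_ : shift_index _ _ = [ffun=> 1%R]); first by rewrite cell0.
  by apply/ffunP => i'; rewrite !ffunE addr0.
have [km Hkm] := choice cells.
pose J := (nat * {ffun 'I_n -> bool})%type.
pose c (j : J) := ((km j.1).1, shift_index (km j.1).2 j.2).
pose D' := [set j : J | D j.1 /\ E `&` cell a L (c j) !=set0].
have pts j : exists x, D' j -> E x /\ cell a L (c j) x.
  have [[_ [x [Ex cx]]]|nD] := pselect (D' j); first by exists x.
  by exists 0%R.
have [x Hx] := choice pts.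
have := @stopping_cells R n delta a L L0 nu E t (ltW t0) EQ nuQ dense J D'
  (fun j => (c j).1) x.
move=> /(_ _ _)/le_trans; apply.
- by move=> j /Hx[].
- move=> y Ey; have [i Di yi] := cov y Ey.
  have [_ /(_ y)[|e _ ye]] := Hkm i Di; first by split=> //; exact: EQ.
  have D'j : D' (i, e) by split=> //; exists y.
  exists (i, e) => //; have [_] := Hx _ D'j.
  by rewrite [c _]surjective_pairing => /cellP ->.
apply: (@le_trans _ _ (((1 + 2 * 2 `^ delta) * t)%:E *
  \esum_(j in D `*`` (fun=> [set: {ffun 'I_n -> bool}])) ((2 * s j.1) `^ delta)%:E)).
  apply: lee_wpmul2l.
    by rewrite lee_fin mulr_ge0 ?(ltW t0)// addr_ge0// mulr_ge0// powR_ge0.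
  apply: (@le_trans _ _ (\esum_(j in D') ((2 * s j.1) `^ delta)%:E)).
    apply: le_esum => -[i e] [/= Di _]; rewrite lee_fin ge0_ler_powR ?nnegrE ?(ltW delta0)//.
    - exact/ltW/side_gt0.
    - by rewrite mulr_ge0// ltW// s0.
    - by have [] := Hkm i Di.
  by apply: subset_esum => -[i e] [/= Di _].
rewrite -(@esum_esum _ _ _ _ _ (fun i (e : {ffun 'I_n -> bool}) => ((2 * s i) `^ delta)%:E)); last first.
  by move=> *; rewrite lee_fin powR_ge0.
pose N := (#|{ffun 'I_n -> bool}|%:R * 2 `^ delta : R)%R.
apply: (@le_trans _ _ (((1 + 2 * 2 `^ delta) * t)%:E *
  (N%:E * \esum_(j in D) ((s j) `^ delta)%:E))).
  apply: lee_wpmul2l.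
    by rewrite lee_fin mulr_ge0 ?(ltW t0)// addr_ge0// mulr_ge0// powR_ge0.
  apply: le_trans; last apply: esum_le_mull.
  - apply: le_esum => i Di; rewrite esum_finType; last by move=> *; rewrite lee_fin powR_ge0.
    rewrite sumEFin sumr_const -EFinM lee_fin powRM ?(ltW (s0 _ Di))//.
    by rewrite /N -mulrA -[leLHS]mulr_natl.
  - by rewrite /N mulr_ge0// powR_ge0.
  - by move=> *; rewrite lee_fin powR_ge0.
rewrite muleA -EFinM; have -> // : ((1 + 2 * 2 `^ delta) * t * N = stopping_factor * t)%R.
by rewrite /stopping_factor /N; ring.
Qed.

End StoppingContent.

(** * The reverse Hoelder inequality *)

Section RealLemmas.
Variable R : realType.

(** If T is the tail sum from k on, then x k >= T / A, so that the tail from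
    k + 1 on is at most (1 - 1 / A) T. Finite tails are used, so that no
    convergence has to be assumed. *)
Lemma tail_sum_decay (x : nat -> R) (A : R) : 1 < A -> (forall k, 0 <= x k) ->
  (forall k m, \sum_(j < m) x (k + j)%N <= A * x k) ->
  forall k, x k <= A * (1 - A^-1) ^+ k * x 0%N.
Proof.
move=> A1 x0 tailx k.
have A0 : 0 < A by exact: lt_trans A1.
have theta0 : 0 <= 1 - A^-1 by rewrite subr_ge0 invf_le1// ltW.
have decay m : \sum_(j < m) x (k + j)%N <=
    (1 - A^-1) ^+ k * \sum_(j < m + k) x j.
  elim: k m => [|k IH] m; first by rewrite expr0 mul1r addn0.
  rewrite exprS -mulrA; apply: le_trans (ler_wpM2l theta0 (_ : _ <= _)); last first.
    by have := IH m.+1; rewrite addSnnS; apply.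
  have split : \sum_(j < m.+1) x (k + j)%N = x k + \sum_(j < m) x (k.+1 + j)%N.
    rewrite big_ord_recl/= addn0; congr (_ + _); apply: eq_bigr => j _.
    by rewrite /bump leq0n add1n addSnnS.
  have := tailx k m.+1; rewrite split -ler_pdivrMl// mulrDr.
  by rewrite mulrBl mul1r mulrDr; lra.
apply: le_trans (_ : \sum_(j < 1) x (k + j)%N <= _); first by rewrite big_ord1 addn0.
apply: le_trans (decay 1%N) _; rewrite -mulrA mulrCA ler_wpM2l ?exprn_ge0//.
exact: (tailx 0%N).
Qed.

Lemma exponent_below (theta : R) : 0 < theta < 1 ->
  exists2 e : R, 0 < e & 2 `^ e * theta < 1.
Proof.
move=> /andP[t0 t1]; pose r := (1 + theta^-1) / 2.
have ti : 1 < theta^-1 by rewrite invf_gt1.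
have r1 : 1 < r by rewrite /r; lra.
have ln20 : 0 < ln (2 : R) by rewrite ln_gt0// ltr1n.
exists (ln r / ln 2); first by rewrite divr_gt0// ln_gt0.
rewrite /powR pnatr_eq0/= divfK ?gt_eqF// lnK ?posrE; last by lra.
rewrite -[ltRHS](mulVf (lt0r_neq0 t0)) ltr_pM2r// /r; lra.
Qed.

Lemma geometric_sum_le (r : R) (m : nat) : 0 <= r < 1 ->
  \sum_(i < m) r ^+ i <= (1 - r)^-1.
Proof.
move=> /andP[r0 r1]; rewrite -[leRHS]mul1r ler_pdivlMr ?subr_gt0//.
rewrite mulrC -opprB mulNr -subrX1 opprB.
by rewrite lerBlDr lerDl exprn_ge0.
Qed.

Lemma powR_exprn (x r : R) (k : nat) : 0 <= x -> (x ^+ k) `^ r = (x `^ r) ^+ k.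
Proof. by move=> x0; rewrite -powR_mulrn// powRAC powR_mulrn// powR_ge0. Qed.

End RealLemmas.

Section ReverseHoelder.
Local Open Scope ereal_scope.
Variables (R : realType) (n : nat) (delta : R).
Hypothesis delta0 : (0 < delta)%R.

Lemma choquet_null (E : set 'rV[R]_n) (g : 'rV[R]_n -> \bar R) :
  hcontent delta E = 0 -> choquet delta E g = 0.
Proof.
move=> E0; apply: integral0_eq => t _; apply/eqP.
by rewrite eq_le hcontent_ge0 andbT -E0; apply: le_hcontent => x [].
Qed.

(** A quantitative A_infinity condition on sigma: if the average over a cube
    exceeds t then sigma > eta t on at least half of it, in content. *)
Definition oscillates_above (eta : R) (sigma : 'rV[R]_n -> \bar R) :=
  forall b s t, (0 < s)%R -> (0 < t)%R ->
  (t * s `^ delta)%:E < choquet delta (cube b s) sigma ->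
  (s `^ delta)%:E <=
    2%:E * hcontent delta [set x | cube b s x /\ (eta * t)%:E < sigma x].

Section LevelSets.
Variables (eta : R) (sigma : 'rV[R]_n -> \bar R) (a : 'rV[R]_n) (L S : R).
Hypothesis eta0 : (0 < eta)%R.
Hypothesis dense : oscillates_above eta sigma.
Hypothesis L0 : (0 < L)%R.
Hypothesis S0 : (0 < S)%R.
Hypothesis avg : choquet delta (cube a L) sigma = (S * L `^ delta)%:E.

Let lev u := [set x | cube a L x /\ u%:E < sigma x].

(** The stopping-time estimate for the outer measure given by sigma, at the
    threshold t = u. *)
Lemma choquet_level_le u : (S <= u)%R ->
  choquet delta (lev (eta * u)) sigma <=
  (stopping_factor n delta * u)%:E * hcontent delta (lev (eta * u)).
Proof.
move=> Su; have u0 : (0 < u)%R by exact: lt_le_trans Su.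
apply: (@le_stopping_content R n delta delta0 a L (choquet_on delta sigma)) => //.
- by move=> x [].
- rewrite [leLHS]avg lee_fin ler_wpM2r ?powR_ge0//.
- move=> b s s0 sub /(dense s0 u0) /le_trans; apply.
  by apply: lee_wpmul2l => //; apply: le_hcontent => x [bx ux]; split=> //; split=> //; exact: sub.
Qed.

Let phi k := fine (hcontent delta (lev (eta * S * 2 ^+ k))).

Lemma level_fin u : hcontent delta (lev u) \is a fin_num.
Proof.
rewrite ge0_fin_numE ?hcontent_ge0//.
apply: le_lt_trans (ltry (L `^ delta)).
by apply: le_trans (hcontent_cube_le delta a L0); apply: le_hcontent => x [].
Qed.

Lemma phi_ge0 k : (0 <= phi k)%R.
Proof. by rewrite fine_ge0// hcontent_ge0. Qed.

(** The constant that the proof gives is the first term; 2 is added to make it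
    visibly larger than 1. *)
Definition tail_constant := (2 * stopping_factor n delta / eta + 2)%R.

(** The layer-cake sum bounds the left-hand side by the integral of sigma over
    its superlevel set, and the stopping-time estimate bounds that integral by
    the first term of the sum. *)
Lemma sum_levels_le k m :
  (\sum_(j < m) (eta * S * 2 ^+ (k + j) * phi (k + j)) <=
   tail_constant * (eta * S * 2 ^+ k * phi k))%R.
Proof.
have s0 : (0 < eta * S)%R by rewrite mulr_gt0.
have sk0 : (0 < eta * S * 2 ^+ k)%R by rewrite mulr_gt0// exprn_gt0.
have Sk : (S <= S * 2 ^+ k)%R.
  by rewrite ler_peMr ?(ltW S0)// exprn_ege1// ler1n.
have lvl j : (eta * S * 2 ^+ k * 2 ^+ j = eta * S * 2 ^+ (k + j))%R.
  by rewrite -mulrA -exprD.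
have := @sum_superlevel_le_choquet R n delta (lev (eta * S * 2 ^+ k)) sigma _ m sk0.
rewrite (eq_bigr (fun j : 'I_m => (eta * S * 2 ^+ (k + j) * phi (k + j))%:E)).
  rewrite sumEFin => h; rewrite -lee_fin; apply: (le_trans h).
  have := choquet_level_le Sk; rewrite mulrA => h2.
  apply: (le_trans (lee_wpmul2l (_ : 0 <= 2%:E) h2)) => //.
  rewrite -(fineK (level_fin _)) -/(phi k) muleA -!EFinM lee_fin.
  have -> : (2 * (stopping_factor n delta * (S * 2 ^+ k)) * phi k =
    (2 * stopping_factor n delta / eta) * (eta * S * 2 ^+ k * phi k))%R.
    by field; rewrite gt_eqF.
  rewrite ler_wpM2r ?mulr_ge0 ?phi_ge0 ?exprn_ge0 ?(ltW eta0) ?(ltW S0)//.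
  by rewrite /tail_constant lerDl.
move=> j _; rewrite lvl [in RHS]EFinM; congr (_ * _).
rewrite /phi fineK ?level_fin// /superlevel; congr hcontent.
apply/seteqP; split=> x /=; first by move=> [[Qx _] h].
move=> [Qx h]; split=> //; split=> //; apply: le_lt_trans h; rewrite lee_fin.
by rewrite ler_wpM2l ?(ltW s0)// ler_weXn2l ?ler1n// leq_addr.
Qed.

Lemma tail_constant_gt1 : (1 < tail_constant)%R.
Proof.
have : (0 < 2 * stopping_factor n delta / eta)%R.
  by rewrite divr_gt0// mulr_gt0// stopping_factor_gt0.
by rewrite /tail_constant; lra.
Qed.

(** The content at level k decays faster than the level 2^k grows, by the
    factor (1 - 1 / A)^k, where A is [tail_constant]. *)
Lemma level_decay k :
  (phi k <= tail_constant * ((1 - tail_constant^-1) / 2) ^+ k * L `^ delta)%R.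
Proof.
have A1 := tail_constant_gt1; have A0 := lt_trans ltr01 A1.
have s0 : (0 < eta * S)%R by rewrite mulr_gt0.
have th0 : (0 <= 1 - tail_constant^-1)%R by rewrite subr_ge0 invf_le1// ltW.
have := @tail_sum_decay R (fun k => eta * S * 2 ^+ k * phi k)%R tail_constant A1.
move=> /(_ _ sum_levels_le k)/=; rewrite expr0 mulr1 => h.
have {}h := h (fun k => mulr_ge0 (mulr_ge0 (ltW s0) (exprn_ge0 k (ler0n R 2))) (phi_ge0 k)).
have phi0 : (phi 0 <= L `^ delta)%R.
  rewrite -lee_fin fineK ?level_fin//.
  by apply: le_trans (hcontent_cube_le delta a L0); apply: le_hcontent => x [].
apply: le_trans (_ : tail_constant * ((1 - tail_constant^-1) / 2) ^+ k * phi 0 <= _)%R; last first.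
  by rewrite ler_wpM2l// mulr_ge0 ?(ltW A0)// exprn_ge0// divr_ge0.
have p2 : (0 < 2 ^+ k :> R)%R by rewrite exprn_gt0.
rewrite expr_div_n -(ler_pM2l (mulr_gt0 s0 p2)); apply: (le_trans h).
rewrite le_eqVlt; apply/orP; left; apply/eqP; field.
by rewrite gt_eqF.
Qed.

End LevelSets.

(** Split the cube along the levels s0 2^k with s0 = eta S. On the k-th layer
    sigma^(1+e) is at most (s0 2^(k+1))^(1+e), and the content decays like
    (theta / 2)^k with theta = 1 - 1 / A and A = [tail_constant]; the sum is a geometric series of ratio
    2^e theta < 1. *)
Lemma reverse_hoelder (eta : R) : (0 < eta)%R ->
  exists e M : R, [/\ (0 < e)%R, (0 < M)%R &
    forall sigma : 'rV[R]_n -> \bar R, (forall x, 0 <= sigma x) ->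
    hcontent delta [set x | sigma x = +oo] = 0 ->
    oscillates_above eta sigma ->
    forall a L S, (0 < L)%R -> (0 < S)%R ->
    choquet delta (cube a L) sigma = (S * L `^ delta)%:E ->
    choquet delta (cube a L) (fun x => sigma x `^ (1 + e)) <=
      (M * S `^ (1 + e) * L `^ delta)%:E].
Proof.
move=> eta0; pose A := tail_constant eta.
have A1 : (1 < A)%R := tail_constant_gt1 eta0.
have A0 : (0 < A)%R := lt_trans ltr01 A1.
pose theta := (1 - A^-1)%R.
have theta01 : (0 < theta < 1)%R.
  by rewrite subr_gt0 invf_lt1// A1 gtrBl invr_gt0 A0.
have [e e0 rho1] := exponent_below theta01.
have /andP[theta0 _] := theta01.
pose rho := (2 `^ e * theta)%R.
have rho0 : (0 <= rho)%R by rewrite mulr_ge0 ?powR_ge0// ltW.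
have e1 : (0 <= 1 + e)%R by rewrite addr_ge0// ltW.
pose c := (2 `^ (1 + e) * A)%R.
have c0 : (0 <= c)%R by rewrite mulr_ge0 ?powR_ge0// ltW.
exists e, ((1 + c / (1 - rho)) * eta `^ (1 + e))%R; split=> //.
  by rewrite mulr_gt0 ?powR_gt0// ltr_wpDr// divr_ge0// subr_ge0 ltW.
move=> sigma sigma0 sigmay dense a L S L0 S0 avg.
pose s0 := (eta * S)%R; have s00 : (0 < s0)%R by rewrite mulr_gt0.
pose tau x := sigma x `^ (1 + e).
pose Z := cube a L `&` [set x | sigma x = +oo].
pose F := cube a L `&` [set x | sigma x <= s0%:E].
pose B k := cube a L `&` [set x | (s0 * 2 ^+ k)%:E < sigma x <= (s0 * 2 ^+ k.+1)%:E].
have tau_le x (u : R) : (0 <= u)%R -> sigma x <= u%:E -> tau x <= (u `^ (1 + e))%:E.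
  move=> u0 su; rewrite -poweR_EFin; apply: gt0_ler_poweR => //.
  - by rewrite in_itv/= sigma0 leey.
  - by rewrite in_itv/= lee_fin u0 leey.
have cov : cube a L `<=` Z `|` (F `|` \bigcup_k B k).
  move=> x Qx; have [sy|sy] := eqVneq (sigma x) +oo; first by left.
  right; have sfin : sigma x \is a fin_num by rewrite ge0_fin_numE// ltey.
  have [sF|] := leP (sigma x) s0%:E; [by left|move=> s0x; right].
  have /ex_minnP[k kx kmin] : exists k, sigma x <= (s0 * 2 ^+ k)%:E.
    exists (Num.truncn (fine (sigma x) / s0)).+1; rewrite -(fineK sfin) lee_fin.
    rewrite mulrC -ler_pdivrMr//; apply: ltW; apply: lt_le_trans (truncnS_gt _) _.
    by rewrite -natrX ler_nat ltnW// ltn_expl.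
  case: k kx kmin => [|k] kx kmin; first by rewrite expr0 mulr1 leNgt s0x in kx.
  exists k => //; split=> //=; rewrite kx andbT ltNge; apply/negP => /kmin.
  by rewrite ltnn.
have nuZ : choquet delta Z tau = 0.
  apply: choquet_null; apply/eqP; rewrite eq_le hcontent_ge0 andbT -sigmay.
  by apply: le_hcontent => x [].
have nuF : choquet delta F tau <= (s0 `^ (1 + e) * L `^ delta)%:E.
  apply: (@le_trans _ _ ((s0 `^ (1 + e))%:E * hcontent delta F)).
    apply: choquet_le; first exact: powR_ge0.
    by move=> x [_ /tau_le]; apply; exact: ltW.
  rewrite EFinM lee_wpmul2l ?lee_fin ?powR_ge0//.
  by apply: le_trans (hcontent_cube_le delta a L0); apply: le_hcontent => x [].
have nuB k : choquet delta (B k) tau <= (s0 `^ (1 + e) * L `^ delta * c * rho ^+ k)%:E.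
  have sk : (0 <= s0 * 2 ^+ k.+1)%R by rewrite mulr_ge0 ?(ltW s00)// exprn_ge0.
  apply: (@le_trans _ _ (((s0 * 2 ^+ k.+1) `^ (1 + e))%:E * hcontent delta (B k))).
    apply: choquet_le; first exact: powR_ge0.
    by move=> x [_ /andP[_]]; exact: tau_le.
  apply: (@le_trans _ _ (((s0 * 2 ^+ k.+1) `^ (1 + e))%:E *
      hcontent delta [set x | cube a L x /\ (eta * S * 2 ^+ k)%:E < sigma x])).
    apply: lee_wpmul2l; first by rewrite lee_fin powR_ge0.
    by apply: le_hcontent => x [Qx /andP[]].
  rewrite -(fineK (level_fin _ _ L0 _)) -EFinM lee_fin.
  apply: le_trans (ler_wpM2l (powR_ge0 _ _) (level_decay eta0 dense L0 S0 avg k)) _.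
  rewrite -/A -/theta powRM ?(ltW s00) ?exprn_ge0// powR_exprn// exprS.
  have two_e : (2 `^ (1 + e) = 2 * 2 `^ e :> R)%R.
    by rewrite powRD ?powRr1// pnatr_eq0 implybT.
  rewrite le_eqVlt; apply/orP; left; apply/eqP.
  rewrite /c /rho two_e expr_div_n !exprMn.
  by field; rewrite expf_neq0// pnatr_eq0.
have nuBs : choquet delta (\bigcup_k B k) tau <=
    (s0 `^ (1 + e) * L `^ delta * c * (1 - rho)^-1)%:E.
  apply: le_trans (choquet_sigma_subadditive delta tau B) _.
  apply: lime_le.
    by apply: is_cvg_nneseries => k _ _; exact: choquet_ge0.
  apply: nearW => m; apply: le_trans (lee_sum _ (fun k _ => nuB k)) _.
  rewrite sumEFin lee_fin -mulr_sumr; apply: ler_wpM2l.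
    by rewrite mulr_ge0// mulr_ge0 ?powR_ge0.
  by rewrite big_mkord geometric_sum_le// rho0.
have := le_outer_measure (choquet_on delta tau) _ _ cov.
move=> /le_trans; apply; apply: le_trans (outer_measureU2 _ _ _) _.
rewrite [X in X + _]nuZ add0e; apply: le_trans (outer_measureU2 _ _ _) _.
apply: le_trans (leeD nuF nuBs) _; rewrite -EFinD lee_fin.
rewrite /s0 powRM ?(ltW eta0) ?(ltW S0)// le_eqVlt; apply/orP; left; apply/eqP.
by field; rewrite subr_eq0 gt_eqF.
Qed.

End ReverseHoelder.

(** * Muckenhoupt weights *)

Section Muckenhoupt.
Local Open Scope ereal_scope.
Variables (R : realType) (n : nat) (delta p : R).
Hypothesis delta0 : (0 < delta)%R.
Hypothesis p1 : (1 < p)%R.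
Hypothesis content_cube : forall (a : 'rV[R]_n) l, (0 < l)%R ->
  hcontent delta (cube a l) = (l `^ delta)%:E.

Let p10 : (0 < p - 1)%R. Proof. by rewrite subr_gt0. Qed.

Lemma choquet_gt0 (E : set 'rV[R]_n) (g : 'rV[R]_n -> \bar R) :
  0 < hcontent delta E -> (forall x, 0 <= g x) ->
  hcontent delta [set x | g x = 0] = 0 -> 0 < choquet delta E g.
Proof.
move=> E0 g0 gz; rewrite lt0e choquet_ge0 andbT; apply/eqP => choq0.
pose F k := E `&` [set x | (k.+1%:R^-1)%:E <= g x].
have F0 k : hcontent delta (F k) = 0.
  apply/eqP; rewrite eq_le hcontent_ge0 andbT.
  have k0 : (0 < k.+1%:R^-1 :> R)%R by rewrite invr_gt0 ltr0n.
  rewrite -(@lee_pmul2l _ (k.+1%:R^-1)%:E)// mule0 -choq0.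
  by apply: choquet_ge; [exact: ltW|move=> x []|move=> x []].
have cov : E `<=` [set x | g x = 0] `|` \bigcup_k F k.
  move=> x Ex; have [gx0|gx0] := eqVneq (g x) 0; first by left.
  right; have gx : 0 < g x by rewrite lt0e gx0 g0.
  case gxE : (g x) gx => [v||//] gx; last by exists 0%N => //; split=> //=; rewrite gxE leey.
  move: gx; rewrite lte_fin => v0; exists (Num.truncn v^-1) => //; split=> //=.
  rewrite gxE lee_fin -[leRHS]invrK lef_pV2 ?posrE ?invr_gt0// ?ltr0n//.
  exact/ltW/truncnS_gt.
have := le_hcontent delta cov; apply/negP; rewrite -ltNge; apply: le_lt_trans E0.
apply: le_trans (outer_measureU2 _ _ _) _.
rewrite [X in X + _]gz add0e; apply: le_trans (hcontent_sigma_subadditive _ _) _.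
by rewrite eseries0// => k _ _; exact: F0.
Qed.

Definition dual_weight (w : 'rV[R]_n -> \bar R) x := (w x)^-1 `^ (p - 1)^-1.

Variables (w : 'rV[R]_n -> \bar R) (K : R).
Hypothesis w0 : forall x, 0 <= w x.
Hypothesis w_ae : hcontent_ae delta (fun x => 0 < w x < +oo).
Hypothesis ApK : Ap_const delta p w <= K%:E.

Let sigma := dual_weight w.

Lemma dual_weight_ge0 x : 0 <= sigma x.
Proof. exact: poweR_ge0. Qed.

Lemma dual_weight_null (v : \bar R) : v = 0 \/ v = +oo ->
  hcontent delta [set x | sigma x = v] = 0.
Proof.
move=> hv; apply/eqP; rewrite eq_le hcontent_ge0 andbT -[leRHS]w_ae.
apply: le_hcontent => x /= sx /andP[wx wy]; move: hv sx; rewrite /sigma /dual_weight.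
have wfin : w x \is a fin_num by rewrite ge0_fin_numE.
have : (w x)^-1 \is a fin_num by rewrite fin_numV ?(gt_eqF wx)// gt_eqF// (lt_trans _ wx).
have : 0 < (w x)^-1 by rewrite inve_gt0 ?(gt_eqF wx) ?(lt_eqF wy).
move=> i0 ifin [->|->] sx; last first.
  by have := fin_num_poweR (p - 1)^-1 ifin; rewrite sx.
by have := poweR_gt0 (p - 1)^-1 i0; rewrite sx ltxx.
Qed.

(** Both averages are positive, because w is neither 0 nor infinite almost
    everywhere and a cube has positive content. As W S^(p-1) is bounded, neither
    of them is infinite, and the A_p inequality can be stated for real numbers. *)
Lemma Ap_averages (a : 'rV[R]_n) l : (0 < l)%R -> exists W S : R,
  [/\ (0 < W)%R /\ (0 < S)%R,
      choquet delta (cube a l) w = (W * l `^ delta)%:E,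
      choquet delta (cube a l) sigma = (S * l `^ delta)%:E &
      (W * S `^ (p - 1) <= K)%R].
Proof.
move=> l0; have ld : (0 < l `^ delta)%R by rewrite powR_gt0.
have Q0 : 0 < hcontent delta (cube a l) by rewrite content_cube.
have w_gt0 : 0 < choquet delta (cube a l) w.
  apply: choquet_gt0 => //; apply/eqP; rewrite eq_le hcontent_ge0 andbT -[leRHS]w_ae.
  by apply: le_hcontent => x /= ->; rewrite ltxx.
have s_gt0 : 0 < choquet delta (cube a l) sigma.
  by apply: choquet_gt0 => //; [exact: dual_weight_ge0|apply: dual_weight_null; left].
have : ((l `^ delta)^-1)%:E * choquet delta (cube a l) w *
    (((l `^ delta)^-1)%:E * choquet delta (cube a l) sigma) `^ (p - 1) <= K%:E.
  apply: le_trans ApK; apply: ereal_sup_ubound; exists a, l; split=> //.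
  by rewrite content_cube// inver gt_eqF.
have il : 0 < ((l `^ delta)^-1)%:E by rewrite lte_fin invr_gt0.
case: (choquet delta (cube a l) w) w_gt0 => [W||//] W0; last first.
  by rewrite gt0_muley// gt0_mulye// poweR_gt0// mule_gt0.
case: (choquet delta (cube a l) sigma) s_gt0 => [S||//] S0; last first.
  by rewrite (gt0_muley il) poweRyr ?gt_eqF// gt0_muley// mule_gt0.
rewrite -!EFinM lee_fin => h.
exists ((l `^ delta)^-1 * W)%R, ((l `^ delta)^-1 * S)%R; split=> //.
- by split; rewrite mulr_gt0// invr_gt0.
- by rewrite mulrC mulVKf// gt_eqF.
- by rewrite mulrC mulVKf// gt_eqF.
Qed.

Lemma weight_ge_of_dual_le x (u : R) : (0 < u)%R -> sigma x <= u%:E ->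
  ((u `^ (p - 1))^-1)%:E <= w x.
Proof.
rewrite /sigma /dual_weight => u0; have := w0 x.
case: (w x) => [v||//]; last by move=> *; rewrite leey.
rewrite lee_fin => v0 su.
have vp : (0 < v)%R.
  rewrite lt_neqAle v0 andbT eq_sym; apply/eqP => vz; move: su.
  by rewrite vz inve0 poweRyr// invr_eq0 gt_eqF.
move: su; rewrite inver gt_eqF// poweR_EFin !lee_fin => su.
rewrite -[leRHS]invrK lef_pV2 ?posrE ?invr_gt0 ?powR_gt0//.
have := ge0_ler_powR (ltW p10) _ _ su; rewrite !nnegrE powR_ge0 (ltW u0) => /(_ isT isT).
by rewrite -powRrM mulVf ?gt_eqF// powRr1// invr_ge0.
Qed.

(** Let F be the part of the cube where sigma <= eta t. There w is at least
    (eta t)^(-(p-1)), so the content of F is at most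
    s^delta eta^(p-1) <w> t^(p-1) <= s^delta eta^(p-1) K, which is at most half
    of s^delta. *)
Lemma Ap_oscillates (eta : R) : (0 < eta)%R -> (2 * K * eta `^ (p - 1) <= 1)%R ->
  oscillates_above delta eta sigma.
Proof.
move=> eta0 etaK b s t s0 t0 big.
have sd : (0 < s `^ delta)%R by rewrite powR_gt0.
have [W [S [[W0 S0] avgw avgs WS]]] := Ap_averages b s0.
have tS : (t < S)%R by move: big; rewrite avgs lte_fin ltr_pM2r.
pose G := [set x | cube b s x /\ (eta * t)%:E < sigma x].
pose F := [set x | cube b s x /\ sigma x <= (eta * t)%:E].
have u0 : (0 < eta * t)%R by rewrite mulr_gt0.
have fin E : E `<=` cube b s -> hcontent delta E \is a fin_num.
  move=> Es; rewrite ge0_fin_numE ?hcontent_ge0//; apply: le_lt_trans (ltry (s `^ delta)).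
  by rewrite -(content_cube b)//; exact: le_hcontent.
have Ff : hcontent delta F \is a fin_num by apply: fin => x [].
have Gf : hcontent delta G \is a fin_num by apply: fin => x [].
have cov : (s `^ delta)%:E <= hcontent delta G + hcontent delta F.
  rewrite -(content_cube b)//; apply: le_trans (outer_measureU2 _ _ _).
  by apply: le_hcontent => x Qx; have [h|h] := ltP (eta * t)%:E (sigma x); [left|right].
have : ((eta * t) `^ (p - 1))^-1%:E * hcontent delta F <= (W * s `^ delta)%:E.
  rewrite -avgw; apply: choquet_ge.
  - by rewrite invr_ge0 powR_ge0.
  - by move=> x [].
  - by move=> x [_]; exact: weight_ge_of_dual_le.
move: cov; rewrite -(fineK Ff) -/G -(fineK Gf) -EFinD -!EFinM !lee_fin => cov.
rewrite ler_pdivrMl ?powR_gt0// powRM ?(ltW eta0) ?(ltW t0)// => hF.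
have ht : (W * t `^ (p - 1) <= K)%R.
  apply: le_trans WS; rewrite ler_wpM2l ?(ltW W0)// ge0_ler_powR ?nnegrE ?(ltW p10) ?(ltW t0) ?(ltW S0) ?(ltW tS)//.
have {}hF : (2 * fine (hcontent delta F) <= s `^ delta)%R.
  apply: (@le_trans _ _ (2 * (eta `^ (p - 1) * K * s `^ delta))%R).
    rewrite ler_pM2l//; apply: (le_trans hF).
    rewrite mulrA ler_pM2r// -mulrA ler_wpM2l ?powR_ge0//.
    by rewrite mulrC.
  by rewrite mulrA -[leRHS]mul1r ler_wpM2r ?(ltW sd)//; move: etaK; lra.
lra.
Qed.

End Muckenhoupt.

Theorem theorem1p9 (R : realType) (n : nat) (delta p K : R)
    (hdelta : 0 < delta <= n%:R) (hp : 1 < p) :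
  exists q : R, 1 < q < p /\
    forall w : 'rV[R]_n -> \bar R,
      Ap_weight delta p w -> Ap_const delta p w = K%:E ->
      Ap_weight delta q w.
Proof.
have /andP[delta0 _] := hdelta; have p10 : 0 < p - 1 by rewrite subr_gt0.
have [null|content_cube] := @hcontent_cube_zero_one R n delta.
  exists ((1 + p) / 2); split; first lra.
  move=> w [cw _] _; split=> //; apply: le_lt_trans (ltry 0).
  apply: ge_ereal_sup => _ [a [l [l0 ->]]].
  by rewrite !choquet_null ?null// !mule0 poweR0r ?mule0//; lra.
(* the sign of K is unknown, as q is chosen before w is given *)
pose K' := Num.max K 1.
have K'0 : 0 < K' by rewrite lt_max ltr01 orbT.
pose eta := (2 * K')^-1 `^ (p - 1)^-1.
have eta0 : 0 < eta by rewrite powR_gt0// invr_gt0 mulr_gt0.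
have etap : eta `^ (p - 1) = (2 * K')^-1.
  by rewrite -powRrM mulVf ?gt_eqF// powRr1// invr_ge0 mulr_ge0// ltW.
have [e [M [e0 M0 RH]]] := @reverse_hoelder R n delta delta0 eta eta0.
have e1 : 0 < 1 + e by rewrite addr_gt0.
pose q := 1 + (p - 1) / (1 + e).
have q1 : q - 1 = (p - 1) / (1 + e) by rewrite /q addrC addKr.
have q10 : 0 < q - 1 by rewrite q1 divr_gt0.
exists q; split.
  rewrite -subr_gt0 q10/= -(ltrD2r (- 1)) q1 ltr_pdivrMr// ltr_pMr//.
  by rewrite ltrDl.
move=> w [cw Apw] ApK; split=> //; have [w0 _ w_ae] := cw.
have ApK' : (Ap_const delta p w <= K%:E)%E by rewrite ApK.
have osc : oscillates_above delta eta (dual_weight p w).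
  apply: (@Ap_oscillates R n delta p) ApK' _ _ _ => //.
  rewrite etap ler_pdivrMr ?mulr_gt0// mul1r ler_pM2l// le_max lexx//.
apply: le_lt_trans (ltry (M `^ (q - 1) * K)); apply: ge_ereal_sup => _ [a [l [l0 ->]]].
have [W [S [[W0 S0] avgw avgs WS]]] := Ap_averages hp content_cube w0 w_ae ApK' a l0.
have ld : 0 < l `^ delta by rewrite powR_gt0.
rewrite content_cube// inver gt_eqF// avgw -EFinM mulrCA mulVf ?gt_eqF// mulr1.
have dual_q : (fun x => (w x)^-1 `^ (q - 1)^-1)%E =
    (fun x => dual_weight p w x `^ (1 + e))%E.
  apply/funext => x; rewrite /dual_weight -poweRrM q1 invf_div.
  by congr (_ `^ _)%E; rewrite mulrC.
rewrite dual_q; set I := choquet _ _ _.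
have Ile : (I <= (M * S `^ (1 + e) * l `^ delta)%:E)%E.
  apply: RH => //; first by move=> x; exact: dual_weight_ge0.
  by apply: dual_weight_null => //; right.
have If : I \is a fin_num.
  by rewrite ge0_fin_numE ?choquet_ge0//; apply: le_lt_trans Ile (ltry _).
move: Ile; rewrite -(fineK If) -!EFinM !lee_fin => Ile.
have {}Ile : (l `^ delta)^-1 * fine I <= M * S `^ (1 + e).
  by rewrite ler_pdivrMl// mulrC.
have I0 : 0 <= (l `^ delta)^-1 * fine I.
  by rewrite mulr_ge0 ?invr_ge0 ?powR_ge0// fine_ge0// choquet_ge0.
apply: (@le_trans _ _ (W * (M * S `^ (1 + e)) `^ (q - 1))).
  rewrite ler_wpM2l ?(ltW W0)// ge0_ler_powR ?nnegrE ?(ltW q10)//.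
  by rewrite mulr_ge0 ?powR_ge0 ?(ltW M0).
rewrite powRM ?powR_ge0 ?(ltW M0)// -powRrM.
rewrite [(1 + e) * _]mulrC [in X in _ * (_ * X)]q1 divfK ?gt_eqF//.
by rewrite mulrCA ler_wpM2l ?powR_ge0.
Qed.
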